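(* Let $E\in\{\mathscr D,\mathscr S\}$, $U\in\mathcal N(E)$ and $\gamma\in C(0)$. If $f_0\in E'$ is a convolution multiplier on $E$ and $\alpha$ is a multi-index, then $D^\alpha(f_0\ast\xi)=f_0\ast D^\alpha\xi$ for all $\xi\in E$, and $$D^\alpha(f_0\ast f)=(D^\alpha f_0)\ast f=f_0\ast D^\alpha f,\qquad\forall\,f\in[E^{(\gamma,U)}].$$
   Context: Test function spaces on $\mathbb R^n$ ($n\ge1$), over $\mathbb C$: for $m\in\mathbb N$, $\mathscr D_m$ is the Fréchet space of infinitely differentiable $\xi:\mathbb R^n\to\mathbb C$ with $\xi(x)=0$ for $|x|>m$, with norms $\|\xi\|_p=\sup_{|x|\le m}\max_{|q|\le p}|D^q\xi(x)|$; $\mathscr D=\bigcup_{m\ge1}\mathscr D_m$ is the strict inductive limit; $\mathscr S$ is the Fréchet space of infinitely differentiable rapidly decreasing functions with norms $\|\xi\|_p=\sup_{|k|,|q|\le p,\,x\in\mathbb R^n}|x^kD^q\xi(x)|$. $E'$ is the space of continuous linear functionals on $E$. $\mathcal N(E)$ is the family of neighborhoods of $0$ in $E$. $C(0)$ is the set of functions $\gamma:\mathbb C\to\mathbb C$ with $\lim_{t\to0}\gamma(t)=\gamma(0)=0$ and $|\gamma(t)|\ge|t|$ for $|t|\le1$. For $\gamma\in C(0)$ and $U\in\mathcal N(E)$, $E^{(\gamma,U)}$ (demi-distributions) is the set of continuous $f:E\to\mathbb C$ with $f(0)=0$ such that for all $x\in E$, $u\in U$ and scalars $|t|\le1$ there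 are scalars $r,s$ with $|r-1|\le|\gamma(t)|$, $|s|\le|\gamma(t)|$ and $f(x+tu)=rf(x)+sf(u)$. $[E^{(\gamma,U)}]$ is its linear span in $\mathbb C^E$. For functionals $f$ on $E$ (in $E'$ or in $[E^{(\gamma,U)}]$, any $U$), $D^\alpha f$ is defined by $(D^\alpha f)(\xi)=f((-1)^{|\alpha|}D^\alpha\xi)$, $\xi\in E$. $f_0\in E'$ is a convolution multiplier on $E$ if (i) for each $\xi\in E$ the function $f_0\ast\xi:\mathbb R^n\to\mathbb C$, $(f_0\ast\xi)(x)=f_0(\xi(x+\cdot))$, belongs to $E$; and (ii) $f_0\ast\xi_k\to0$ in $E$ whenever $\xi_k\to0$ in $E$ (sequences). If $f_0$ is a convolution multiplier then so is $D^\alpha f_0$. For a convolution multiplier $f_0$ and $f\in[E^{(\gamma,U)}]$ (any $U\in\mathcal N(E)$), $f_0\ast f:E\to\mathbb C$ is defined by $(f_0\ast f)(\xi)=f(f_0\ast\xi)$; the functionals $f_0\ast f$ and $D^\alpha f$ lie in $[E^{(\gamma,V)}]$ for some $V\in\mathcal N(E)$. *)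

(* Defs.v *)
From HB Require Import structures.
From mathcomp Require Import all_boot all_order all_algebra.
From mathcomp Require Import boolp classical_sets functions reals.
From mathcomp Require Import topology normedtype landau derive realfun.
From mathcomp Require Import complex ring lra.

Set Implicit Arguments.
Unset Strict Implicit.
Unset Printing Implicit Defensive.

Import Order.TTheory GRing.Theory Num.Theory.
Import numFieldNormedType.Exports.
Local Open Scope classical_set_scope.
Local Open Scope ring_scope.
Local Open Scope complex_scope.

(* Test functions take values in Rcomplex R, the real normed space underlying
   R[i], so that the library's derivative of functions between real normed
   spaces applies; functionals take values in the field R[i]. *)
Section Rcomplex_normedModType.
Variable R : realType.

HB.instance Definition _ := isPointed.Build (Rcomplex R) 0.
HB.instance Definition _ :=
  PseudoMetric.copy (Rcomplex R) (pseudoMetric_normed (Rcomplex R)).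
HB.instance Definition _ :=
  NormedZmod_PseudoMetric_eq.Build R (Rcomplex R) erefl.

Lemma Rcomplex_normrZ (l : R) (x : Rcomplex R) : `|l *: x| = `|l| * `|x|.
Proof.
case: x => a b; rewrite /Num.norm/= !exprMn -mulrDr sqrtrM ?sqr_ge0//.
by rewrite sqrtr_sqr.
Qed.

HB.instance Definition _ :=
  PseudoMetricNormedZmod_Lmodule_isNormedModule.Build R (Rcomplex R)
    Rcomplex_normrZ.

Lemma Rcomplex_normE (z : Rcomplex R) : `|z|%:C = `|z : R[i]|.
Proof. by case: z. Qed.

Lemma Rcomplex_normM (a b : Rcomplex R) :
  `|(a * b : Rcomplex R)| = `|a| * `|b|.
Proof.
apply: complexI; rewrite rmorphM/= !Rcomplex_normE.
exact: (@normrM R[i] a b).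
Qed.

Definition Rcomplex_mul (c z : Rcomplex R) : Rcomplex R := c * z.

Lemma Rcomplex_mul_linear (c : Rcomplex R) : linear (Rcomplex_mul c).
Proof.
case: c => c1 c2 l [u1 u2] [v1 v2]; apply/eqP; rewrite eq_complex/=.
by apply/andP; split; apply/eqP; ring.
Qed.

HB.instance Definition _ (c : Rcomplex R) :=
  GRing.isLinear.Build R (Rcomplex R) (Rcomplex R) _ (Rcomplex_mul c)
    (Rcomplex_mul_linear c).

Lemma lipschitz_linear_continuous (V W : normedModType R) (L : {linear V -> W})
  (k : R) : (forall z, `|L z| <= k * `|z|) -> continuous L.
Proof.
move=> kP; apply: bounded_linear_continuous; apply/linear_boundedP.
exists k; split; first exact: num_real.
by move=> M kM x; apply: le_trans (kP x) _; rewrite ler_wpM2r// ltW.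
Qed.

Lemma Rcomplex_mul_continuous (c : Rcomplex R) :
  continuous (Rcomplex_mul c).
Proof.
apply: (@lipschitz_linear_continuous (Rcomplex R) (Rcomplex R)
  (Rcomplex_mul c) `|c|).
by move=> z; rewrite Rcomplex_normM.
Qed.

Lemma ReRcomplex_continuous : continuous (@complex.Re R : Rcomplex R -> R).
Proof.
apply: (@lipschitz_linear_continuous (Rcomplex R) R
  (@complex.Re R : Rcomplex R -> R) 1).
move=> [a b]; rewrite mul1r /= /Num.norm/= -[X in X <= _]sqrtr_sqr.
by rewrite ler_sqrt ?lerDl ?addr_ge0 ?sqr_ge0.
Qed.

Lemma ImRcomplex_continuous : continuous (@complex.Im R : Rcomplex R -> R).
Proof.
apply: (@lipschitz_linear_continuous (Rcomplex R) R
  (@complex.Im R : Rcomplex R -> R) 1).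
move=> [a b]; rewrite mul1r /= /Num.norm/= -[X in X <= _]sqrtr_sqr.
by rewrite ler_sqrt ?lerDr ?addr_ge0 ?sqr_ge0.
Qed.

End Rcomplex_normedModType.

Section directional_derivatives.
Variable R : realType.

Lemma derive_lin (U V W : normedModType R) (L : {linear V -> W})
    (f : U -> V) (x u : U) :
  continuous L -> differentiable f x ->
  differentiable (L \o f) x /\ 'D_u (L \o f) x = L ('D_u f x).
Proof.
move=> cL df.
have dL : differentiable L (f x) by exact: linear_differentiable.
have dLf : differentiable (L \o f) x by exact: differentiable_comp.
by split=> //; rewrite !deriveE// diff_comp//= diff_lin.
Qed.

Lemma derive_translate (U V : normedModType R) (f : U -> V) (y x u : U) :
  'D_u (fun z => f (y + z)) x = 'D_u f (y + x).
Proof.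
rewrite /derive.
have -> // : (fun h : R => h^-1 *: (((fun z => f (y + z)) \o shift x) (h *: u)
    - f (y + x))) = (fun h => h^-1 *: ((f \o shift (y + x)) (h *: u)
    - f (y + x))).
by apply/funext => h /=; rewrite addrCA.
Qed.

Lemma differentiable_translate (U V : normedModType R) (f : U -> V) (y x : U) :
  differentiable f (y + x) -> differentiable (fun z => f (y + z)) x.
Proof.
move=> df; have : differentiable (f \o (fun z => y + z)) x; last by [].
have dy : differentiable (fun z : U => y + z) x.
  have did : differentiable (id : U -> U) x by [].
  exact: (differentiableD (differentiable_cst y x) did).
exact: (differentiable_comp dy df).
Qed.

Variable V : normedModType R.
Implicit Types (g : V -> R) (x u v : V).

Lemma is_derive_line g x u (s : R) : differentiable g (x + s *: u) ->
  is_derive s 1 (fun t => g (x + t *: u)) ('D_u g (x + s *: u)).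
Proof.
move=> dg.
have E : (fun h : R => h^-1 *: (((fun t => g (x + t *: u)) \o shift s) (h *: 1)
    - g (x + s *: u))) = (fun h : R => h^-1 *: ((g \o shift (x + s *: u)) (h *: u)
    - g (x + s *: u))).
  apply/funext => h /=; congr (_ *: (g _ - _)).
  by rewrite [_ *: 1]mulr1 scalerDl addrCA.
split; last by rewrite /derive E.
by rewrite /derivable E; exact: diff_derivable.
Qed.

Lemma MVT_line g x u (h : R) : 0 < h -> (forall y, differentiable g y) ->
  exists2 c, 0 < c < h & g (x + h *: u) - g x = h * 'D_u g (x + c *: u).
Proof.
move=> h0 dg.
have gl (s : R) : is_derive s 1 (fun t => g (x + t *: u)) ('D_u g (x + s *: u)).
  exact: is_derive_line.
have cl : {within `[0, h], continuous (fun t : R => g (x + t *: u))}.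
  apply: continuous_subspaceT => s; apply/differentiable_continuous.
  by apply/derivable1_diffP; have [] := gl s.
have [c ci cE] := MVT h0 (fun s _ => gl s) cl.
exists c; first by move: ci; rewrite in_itv.
by move: cE; rewrite scale0r addr0 subr0 => ->; rewrite mulrC.
Qed.

Definition second_difference g x a b : R :=
  g (x + a + b) - g (x + a) - (g (x + b) - g x).

Lemma second_differenceC g x a b :
  second_difference g x a b = second_difference g x b a.
Proof.
have swap (p q r s : R) : p - q - (r - s) = p - r - (q - s) by ring.
by rewrite /second_difference swap (addrAC x a b).
Qed.

Lemma second_differenceE g x u v (h : R) : 0 < h ->
  (forall y, differentiable g y) -> (forall y, differentiable ('D_u g) y) ->
  exists c d, [/\ 0 < c < h, 0 < d < h &
    second_difference g x (h *: u) (h *: v) = h * (h * 'D_v ('D_u g) (x + c *: u + d *: v))].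
Proof.
move=> h0 dg ddg.
pose G y := g (h *: v + y) - g y.
have dG y : differentiable G y.
  by apply: differentiableB => //; exact: differentiable_translate.
have [c ch cE] := MVT_line x u h0 dG.
have [d dh dE] := MVT_line (x + c *: u) v h0 ddg.
exists c, d; split=> //; rewrite -dE.
have -> : 'D_u g (x + c *: u + h *: v) - 'D_u g (x + c *: u)
    = 'D_u G (x + c *: u).
  rewrite [RHS]deriveB; [|exact/diff_derivable/differentiable_translate
    |exact/diff_derivable].
  by rewrite derive_translate [h *: v + _]addrC.
rewrite /second_difference -cE /G; rewrite ![h *: v + _]addrC.
by [].
Qed.

Lemma half_dist (p q r e : R) :
  `|p - r| < e / 2 -> `|q - r| < e / 2 -> `|p - q| <= e.
Proof.
move=> pr qr; rewrite -(subrKA r) (splitr e).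
by rewrite (le_trans (ler_normD _ _))// ltW// ltrD// distrC.
Qed.

Lemma schwarz g x u v :
  (forall y, differentiable g y) ->
  (forall y, differentiable ('D_u g) y) ->
  (forall y, differentiable ('D_v g) y) ->
  (forall y, differentiable ('D_v ('D_u g)) y) ->
  (forall y, differentiable ('D_u ('D_v g)) y) ->
  'D_u ('D_v g) x = 'D_v ('D_u g) x.
Proof.
move=> dg dug dvg dvug duvg; apply/eqP; rewrite -subr_eq0 -normr_le0.
apply/ler_addgt0Pl => e e0; rewrite addr0.
have e2 : 0 < e / 2 by rewrite divr_gt0.
have c1 := differentiable_continuous (duvg x).
have c2 := differentiable_continuous (dvug x).
move/cvgrPdist_lt: c1 => /(_ _ e2) /nbhs_normP[d1 /= d10 H1].
move/cvgrPdist_lt: c2 => /(_ _ e2) /nbhs_normP[d2 /= d20 H2].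
pose k := `|u| + `|v| + 1.
have k0 : 0 < k by rewrite /k ltr_wpDl ?addr_ge0.
pose h := Num.min d1 d2 / k.
have h0 : 0 < h by rewrite divr_gt0 // lt_min d10.
have small c d w z : `|w| + `|z| = `|u| + `|v| -> 0 < c < h -> 0 < d < h ->
    `|x - (x + c *: w + d *: z)| < Num.min d1 d2.
  move=> wz /andP[c0 ch] /andP[d0 dh].
  rewrite -addrA opprD addrA subrr sub0r normrN.
  apply: (@le_lt_trans _ _ (h * (`|u| + `|v|))).
    rewrite (le_trans (ler_normD _ _))// -wz mulrDr !normrZ.
    rewrite (gtr0_norm c0) (gtr0_norm d0).
    by rewrite lerD// ler_wpM2r// ltW.
  have -> : Num.min d1 d2 = h * k by rewrite /h divfK// gt_eqF.
  by rewrite ltr_pM2l// /k ltrDl.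
have [c [d [ch dh E1]]] := second_differenceE x v h0 dg dug.
have [c' [d' [ch' dh' E2]]] := second_differenceE x u h0 dg dvg.
have hN0 : h != 0 by rewrite gt_eqF.
have E := mulfI hN0 (mulfI hN0
  (etrans (esym E2) (etrans (second_differenceC g x (h *: v) (h *: u)) E1))).
have s1 := small _ _ _ _ (addrC _ _) ch' dh'.
have s2 := small _ _ _ _ erefl ch dh.
rewrite lt_min in s1; rewrite lt_min in s2.
have {s1} /andP[s1 _] := s1; have {s2} /andP[_ s2] := s2.
have h1 := H1 _ s1; have h2 := H2 _ s2.
exact: (half_dist (eq_ind _ (fun z => `|_ - z| < _) h1 _ E) h2).
Qed.

End directional_derivatives.

Definition multi_index (n : nat) := {ffun 'I_n -> nat}.

Definition mi_deg n (q : multi_index n) : nat := (\sum_i q i)%N.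

Section smooth_functions.
Context {R : realType} {n : nat}.
Implicit Types (f g : 'rV[R]_n -> Rcomplex R) (x y : 'rV[R]_n).
Implicit Types (q k a : multi_index n).

(* The norm of 'rV[R]_n in the library is the max norm. *)
Definition enorm x : R := Num.sqrt (\sum_i x 0 i ^+ 2).

Definition monomial x k : R := \prod_i x 0 i ^+ k i.

Definition partial (i : 'I_n) f : 'rV[R]_n -> Rcomplex R :=
  'D_('e_i : 'rV[R]_n) f.

Definition partials (s : seq 'I_n) f := foldr partial f s.

(* D^q f = d_0^(q 0) (d_1^(q 1) (... (d_(n-1)^(q (n-1)) f))) *)
Definition Dmi q f : 'rV[R]_n -> Rcomplex R :=
  foldr (fun i g => iter (q i) (partial i) g) f (enum 'I_n).

(* Infinite differentiability: every iterated partial derivative is (Frechet)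
   differentiable everywhere. *)
Definition smooth f := forall (s : seq 'I_n) x, differentiable (partials s f) x.

Lemma partials_cat s t f : partials (s ++ t) f = partials s (partials t f).
Proof. exact: foldr_cat. Qed.

Lemma smooth_partials s f : smooth f -> smooth (partials s f).
Proof. by move=> sf t x; rewrite -partials_cat. Qed.

Lemma partialsZ (c : Rcomplex R) s f : smooth f ->
  partials s (Rcomplex_mul c \o f) = Rcomplex_mul c \o partials s f.
Proof.
move=> sf; elim: s => //= i s ->; apply/funext => x.
by have [] := derive_lin ('e_i) (@Rcomplex_mul_continuous R c) (sf s x).
Qed.

Lemma smoothZ (c : Rcomplex R) f : smooth f -> smooth (Rcomplex_mul c \o f).
Proof.
move=> sf s x; rewrite (partialsZ c s sf).
by have [] := derive_lin 0 (@Rcomplex_mul_continuous R c) (sf s x).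
Qed.

Lemma partialsD s f g : smooth f -> smooth g ->
  partials s (f + g) = partials s f + partials s g.
Proof.
move=> sf sg; elim: s => //= i s ->; apply/funext => x.
have df : derivable (partials s f) x 'e_i by exact: diff_derivable (sf s x).
have dg : derivable (partials s g) x 'e_i by exact: diff_derivable (sg s x).
by rewrite /partial (deriveD df dg).
Qed.

Lemma smoothD f g : smooth f -> smooth g -> smooth (f + g).
Proof.
move=> sf sg s x; rewrite (partialsD s sf sg).
exact: differentiableD (sf s x) (sg s x).
Qed.

Lemma partials0 s : partials s 0 = 0.
Proof.
elim: s => //= i s ->; apply/funext => x; rewrite /partial.
exact: (@derive_cst _ _ _ (0 : Rcomplex R)).
Qed.

Lemma smooth0 : smooth 0.
Proof.
by move=> s x; rewrite partials0; exact: (differentiable_cst (0 : Rcomplex R)).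
Qed.

Lemma partials_translate s f y :
  partials s (fun z => f (y + z)) = (fun z => partials s f (y + z)).
Proof.
elim: s => //= i s ->; apply/funext => x.
exact: (derive_translate (partials s f)).
Qed.

Lemma smooth_translate f y : smooth f -> smooth (fun z => f (y + z)).
Proof.
move=> sf s x; rewrite partials_translate.
exact: differentiable_translate (sf s (y + x)).
Qed.

Lemma partialC i j f : smooth f -> partial i (partial j f) = partial j (partial i f).
Proof.
move=> sf; apply/funext => x.
have commL (L : {linear Rcomplex R -> R}) : continuous L ->
    L (partial j (partial i f) x) = L (partial i (partial j f) x).
  move=> cL.
  have LE s l : 'D_('e_l) (L \o partials s f) = L \o partials (l :: s) f.
    by apply/funext => y; have [] := derive_lin ('e_l) cL (sf s y).
  have Ld s y : differentiable (L \o partials s f) y.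
    by have [] := derive_lin 0 cL (sf s y).
  have D1 l : 'D_('e_l) (L \o f) = L \o partials [:: l] f := LE [::] l.
  have D2 l l' : 'D_('e_l) ('D_('e_l') (L \o f)) = L \o partials [:: l; l'] f.
    exact: etrans (congr1 (fun h => 'D_('e_l : 'rV[R]_n) h) (D1 l')) (LE [:: l'] l).
  have d1 l y : differentiable ('D_('e_l) (L \o f)) y.
    by rewrite D1; exact: Ld [:: l] y.
  have d2 l l' y : differentiable ('D_('e_l) ('D_('e_l') (L \o f))) y.
    by rewrite D2; exact: Ld [:: l; l'] y.
  have S := schwarz x (Ld [::]) (d1 j) (d1 i) (d2 i j) (d2 j i).
  have E1 := congr1 (fun h => h x) (D2 i j).
  have E2 := congr1 (fun h => h x) (D2 j i).
  exact: etrans (esym E2) (etrans S E1).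
apply/eqP; rewrite eq_complex; apply/andP; split; apply/eqP.
- exact: esym (commL _ (@ReRcomplex_continuous R)).
- exact: esym (commL _ (@ImRcomplex_continuous R)).
Qed.

Lemma partials_perm s t f : smooth f -> perm_eq s t ->
  partials s f = partials t f.
Proof.
move=> sf st.
have C1 i u g : smooth g ->
    partial i (partials u g) = partials u (partial i g).
  move=> sg; elim: u => //= j u <-.
  by rewrite (partialC i j (smooth_partials u sg)).
have C2 u v g : smooth g ->
    partials u (partials v g) = partials v (partials u g).
  move=> sg; elim: u => //= j u ->.
  by rewrite (C1 j v _ (smooth_partials u sg)).
have := erefl (partials s f); move: st.
apply: (@catCA_perm_ind _ (fun u => partials s f = partials u f)).
move=> s1 s2 s3 ->; rewrite !partials_cat.
by rewrite (C2 s1 s2 _ (smooth_partials s3 sf)).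
Qed.

Definition mi_word q : seq 'I_n := flatten [seq nseq (q i) i | i <- enum 'I_n].

Lemma DmiE q f : Dmi q f = partials (mi_word q) f.
Proof.
rewrite /Dmi /mi_word; elim: (enum _) => //= i s ->.
by rewrite partials_cat; elim: (q i) => //= m ->.
Qed.

Lemma count_mi_word q j : count_mem j (mi_word q) = q j.
Proof.
rewrite /mi_word count_flatten -map_comp sumnE big_map big_enum/=.
rewrite (bigD1 j)//= count_nseq/= eqxx mul1n big1 ?addn0// => i ij.
by rewrite count_nseq/= (negbTE ij).
Qed.

Lemma DmiD q a f : smooth f -> Dmi q (Dmi a f) = Dmi [ffun i => q i + a i]%N f.
Proof.
move=> sf; rewrite !DmiE -partials_cat; apply: partials_perm => //.
apply/allP => j _ /=.
by rewrite count_cat !count_mi_word ffunE.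
Qed.

Lemma smooth_Dmi q f : smooth f -> smooth (Dmi q f).
Proof. by rewrite DmiE; exact: smooth_partials. Qed.

Lemma DmiZ c q f : smooth f ->
  Dmi q (Rcomplex_mul c \o f) = Rcomplex_mul c \o Dmi q f.
Proof. by rewrite !DmiE; exact: partialsZ. Qed.

Lemma Dmi_add q f g : smooth f -> smooth g -> Dmi q (f + g) = Dmi q f + Dmi q g.
Proof. by rewrite !DmiE; exact: partialsD. Qed.

Lemma Dmi0 q : Dmi q 0 = 0.
Proof. by rewrite DmiE partials0. Qed.

Lemma Dmi_translate q f y :
  Dmi q (fun z => f (y + z)) = (fun z => Dmi q f (y + z)).
Proof. by rewrite !DmiE partials_translate. Qed.

Lemma Dmi_continuous q f : smooth f -> continuous (Dmi q f).
Proof. by move=> sf x; apply: differentiable_continuous; rewrite DmiE. Qed.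

Lemma mi_degD q a : mi_deg [ffun i => q i + a i]%N = (mi_deg q + mi_deg a)%N.
Proof. by rewrite /mi_deg -big_split; apply: eq_bigr => i _; rewrite ffunE. Qed.

Lemma smoothN f : smooth f -> smooth (- f).
Proof.
have -> : - f = Rcomplex_mul (-1) \o f.
  by apply/funext => x /=; rewrite /Rcomplex_mul mulN1r.
exact: smoothZ.
Qed.

Lemma DmiN q f : smooth f -> Dmi q (- f) = - Dmi q f.
Proof.
have E g : - g = Rcomplex_mul (-1) \o g.
  by apply/funext => x /=; rewrite /Rcomplex_mul mulN1r.
by rewrite !E; exact: DmiZ.
Qed.

End smooth_functions.

Section seminorms.
Context {R : realType} {n : nat}.
Implicit Types (f g : 'rV[R]_n -> Rcomplex R) (x y : 'rV[R]_n).
Implicit Types (q k a : multi_index n) (m p : nat).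

Definition supported_in m f := forall x, m%:R < enorm x -> f x = 0.

Definition rapidly_decreasing f :=
  forall k q, exists M : R, forall x, `|monomial x k *: Dmi q f x| <= M.

Definition normD m p f : R :=
  sup [set r | exists x q, [/\ enorm x <= m%:R, (mi_deg q <= p)%N &
                               r = `|Dmi q f x|]].

Definition normS p f : R :=
  sup [set r | exists x k q, [/\ (mi_deg k <= p)%N, (mi_deg q <= p)%N &
                                 r = `|monomial x k *: Dmi q f x|]].

Let mi0 : multi_index n := [ffun=> 0%N].

Let mi_deg0 : mi_deg mi0 = 0%N.
Proof. by rewrite /mi_deg big1// => i _; rewrite ffunE. Qed.

Let enorm0 : enorm (0 : 'rV[R]_n) = 0.
Proof. by rewrite /enorm big1 ?sqrtr0// => i _; rewrite mxE expr0n. Qed.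

Lemma bound_deg p (B : multi_index n -> R) :
  exists M : R, forall q, (mi_deg q <= p)%N -> B q <= M.
Proof.
pose c (t : {ffun 'I_n -> 'I_p.+1}) : multi_index n :=
  [ffun i => nat_of_ord (t i)].
exists (\sum_t `|B (c t)|) => q qp.
have qi i : (q i < p.+1)%N.
  by rewrite ltnS; apply: leq_trans qp; rewrite /mi_deg (bigD1 i)//= leq_addr.
pose t : {ffun 'I_n -> 'I_p.+1} := [ffun i => Ordinal (qi i)].
have -> : q = c t by apply/ffunP => i; rewrite !ffunE.
rewrite (bigD1 t)//= (le_trans (ler_norm _))// lerDl.
by apply: sumr_ge0.
Qed.

Lemma compact_bound m (h : 'rV[R]_n -> Rcomplex R) : continuous h ->
  exists M : R, forall x, enorm x <= m%:R -> `|h x| <= M.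
Proof.
move=> ch.
pose K : set 'rV[R]_n := [set v | forall i, `[- (m%:R : R), m%:R]%classic (v ord0 i)].
have cK : compact K.
  by apply: (@rV_compact R n (fun=> `[- (m%:R : R), m%:R]%classic)) => i;
    exact: segment_compact.
have K0 : K !=set0.
  by exists 0 => i /=; rewrite mxE in_itv/= oppr_le0 ler0n.
have cn : {within K, continuous (fun x => `|h x|)}.
  apply: continuous_subspaceT => x.
  apply: (@continuous_comp _ _ _ h (fun z : Rcomplex R => `|z|)); first exact: ch.
  exact: norm_continuous.
have [c cKc cmax] := EVT_max_rV K0 cK cn.
exists `|h c| => x xm; apply: cmax; apply/mem_set => i /=.
rewrite in_itv/= -ler_norml (le_trans _ xm)// /enorm -sqrtr_sqr.
rewrite ler_sqrt; last by apply: sumr_ge0 => j _; exact: sqr_ge0.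
by rewrite (bigD1 i)//= lerDl; apply: sumr_ge0 => j _; exact: sqr_ge0.
Qed.

Lemma normD_ub m p f x q : smooth f -> enorm x <= m%:R -> (mi_deg q <= p)%N ->
  `|Dmi q f x| <= normD m p f.
Proof.
move=> sf xm qp; apply: ub_le_sup; last by exists x, q.
have /choice[B BP] : forall q, exists M : R, forall x, enorm x <= m%:R ->
    `|Dmi q f x| <= M.
  by move=> q'; apply: compact_bound; exact: Dmi_continuous.
have [M MP] := bound_deg p B.
exists M => _ [y [q' [ym q'p ->]]].
by apply: le_trans (MP _ q'p); exact: BP.
Qed.

Lemma normD_le m p f (M : R) :
  (forall x q, enorm x <= m%:R -> (mi_deg q <= p)%N -> `|Dmi q f x| <= M) ->
  normD m p f <= M.
Proof.
move=> fM; apply: ge_sup.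
  by exists `|Dmi mi0 f 0|, 0, mi0; rewrite enorm0 mi_deg0; split.
by move=> _ [x [q [xm qp ->]]]; exact: fM.
Qed.

Lemma normS_ub p f x k q : rapidly_decreasing f ->
  (mi_deg k <= p)%N -> (mi_deg q <= p)%N ->
  `|monomial x k *: Dmi q f x| <= normS p f.
Proof.
move=> rf kp qp; apply: ub_le_sup; last by exists x, k, q.
have /choice[B BP] : forall kk, exists M : R, forall q x, (mi_deg q <= p)%N ->
    `|monomial x kk *: Dmi q f x| <= M.
  move=> kk; have /choice[B BP] := rf kk.
  have [M MP] := bound_deg p B; exists M => q' y q'p.
  exact: le_trans (BP _ _) (MP _ q'p).
have [M MP] := bound_deg p B.
exists M => _ [y [k' [q' [k'p q'p ->]]]].
by apply: le_trans (MP _ k'p); exact: BP.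
Qed.

Lemma normS_le p f (M : R) :
  (forall x k q, (mi_deg k <= p)%N -> (mi_deg q <= p)%N ->
    `|monomial x k *: Dmi q f x| <= M) ->
  normS p f <= M.
Proof.
move=> fM; apply: ge_sup.
  exists `|monomial 0 mi0 *: Dmi mi0 f 0|, 0, mi0, mi0.
  by rewrite mi_deg0; split.
by move=> _ [x [k [q [kp qp ->]]]]; exact: fM.
Qed.

Lemma Rcomplex_scaler_mul (r : R) (c z : Rcomplex R) :
  r *: Rcomplex_mul c z = Rcomplex_mul c (r *: z).
Proof. by rewrite linearZ. Qed.

Lemma partials_support m s f : supported_in m f ->
  supported_in m (partials s f).
Proof.
move=> sf; elim: s => //= i s IH x xm; rewrite /partial /derive.
apply: lim_near_cst => //.
have ce : continuous (@enorm R n).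
  move=> y; apply: (@continuous_comp _ _ _ (fun x : 'rV[R]_n => \sum_i x 0 i ^+ 2)
    Num.sqrt); last exact: sqrt_continuous.
  move: y; apply: continuous_big => [|j _ y]; first exact: add_continuous.
  apply: (@continuous_comp _ _ _ (fun x : 'rV[R]_n => x 0 j) (fun r => r ^+ 2)).
    exact: coord_continuous.
  exact: exprn_continuous.
have : \forall h \near (0 : R)^', m%:R < enorm (h *: 'e_i + x).
  have ch : (fun h : R => enorm (h *: 'e_i + x)) @ 0^' --> enorm x.
    apply: (@cvg_within_filter _ _ _ (nbhs (0 : R))).
    have -> : enorm x = enorm (0 *: 'e_i + x) by rewrite scale0r add0r.
    apply: (@continuous_comp _ _ _ (fun h : R => h *: 'e_i + x) (@enorm R n));
      last exact: ce.
    apply: cvgD; last exact: cvg_cst.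
    exact: scalel_continuous.
  exact: (cvgr_gt _ ch _ xm).
apply: filterS => h hm /=.
by rewrite (IH _ hm) (IH _ xm) subr0 scaler0.
Qed.

Lemma rapidly_decreasingD f g : smooth f -> smooth g ->
  rapidly_decreasing f -> rapidly_decreasing g -> rapidly_decreasing (f + g).
Proof.
move=> sf sg rf rg k q.
have [[M MP] [N NP]] := (rf k q, rg k q); exists (M + N) => x.
rewrite Dmi_add// [X in monomial x k *: X]/(_ + _) scalerDr.
by rewrite (le_trans (ler_normD _ _))// lerD.
Qed.

Lemma rapidly_decreasingZ c f : smooth f -> rapidly_decreasing f ->
  rapidly_decreasing (Rcomplex_mul c \o f).
Proof.
move=> sf rf k q; have [M MP] := rf k q; exists (`|c| * M) => x.
by rewrite DmiZ//= Rcomplex_scaler_mul Rcomplex_normM ler_wpM2l.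
Qed.

Lemma rapidly_decreasing_Dmi q f : smooth f -> rapidly_decreasing f ->
  rapidly_decreasing (Dmi q f).
Proof. by move=> sf rf k q'; rewrite DmiD//; exact: rf. Qed.

Lemma rapidly_decreasing_weight f q k : rapidly_decreasing f ->
  exists M : R, forall z : 'rV[R]_n, (\prod_i (1 + `|z 0 i| ^+ k i)) * `|Dmi q f z| <= M.
Proof.
move=> rf.
pose kJ (J : {set 'I_n}) : multi_index n :=
  [ffun i => if i \in J then 0%N else k i].
have /choice[B BP] := fun J => rf (kJ J) q.
exists (\sum_J B J) => z.
rewrite bigA_distr/= mulr_suml; apply: ler_sum => J _.
apply: le_trans (BP J z); rewrite normrZ ler_wpM2r//.
rewrite /monomial normr_prod; apply: ler_prod => i _; rewrite ffunE normrX.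
by case: ifP => _; rewrite ?expr0 ?ler01 ?lexx ?exprn_ge0.
Qed.

Lemma rapidly_decreasing_translate f y : rapidly_decreasing f ->
  rapidly_decreasing (fun z => f (y + z)).
Proof.
move=> rf k q; have [M MP] := rapidly_decreasing_weight q k rf.
pose C : R := \prod_i ((1 + `|y 0 i|) ^+ k i * 2 ^+ k i).
have C0 : 0 <= C.
  by apply: prodr_ge0 => i _; rewrite mulr_ge0// exprn_ge0// addr_ge0.
exists (C * M) => x; rewrite Dmi_translate normrZ.
apply: le_trans (ler_wpM2l C0 (MP (y + x))); rewrite mulrA ler_wpM2r//.
rewrite /C -big_split/= /monomial normr_prod; apply: ler_prod => i _.
rewrite normr_ge0/= normrX mxE; set a := y 0 i; set b := x 0 i.
have ab : `|b| <= (1 + `|a|) * (1 + `|a + b|).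
  have : `|b| <= `|a| + `|a + b|.
    by rewrite -{1}(addKr a b) (le_trans (ler_normD _ _))// normrN.
  have := normr_ge0 a; have := normr_ge0 (a + b); nra.
apply: (@le_trans _ _ (((1 + `|a|) * (1 + `|a + b|)) ^+ k i)).
  by rewrite lerXn2r// nnegrE// mulr_ge0// addr_ge0.
rewrite exprMn -mulrA ler_wpM2l ?exprn_ge0 ?addr_ge0//.
set t := `|a + b|; have t0 : 0 <= t by exact: normr_ge0.
have [t1|t1] := leP t 1.
  apply: (@le_trans _ _ (2 ^+ k i)).
    by rewrite lerXn2r ?nnegrE ?addr_ge0//; lra.
  by rewrite ler_peMr ?exprn_ge0// lerDl exprn_ge0.
apply: (@le_trans _ _ ((2 * t) ^+ k i)).
  by rewrite lerXn2r ?nnegrE ?addr_ge0 ?mulr_ge0//; lra.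
by rewrite exprMn ler_wpM2l ?exprn_ge0// lerDr.
Qed.

End seminorms.

Variant test_kind := CompactSupport | RapidDecrease.

Section test_space.
Context {R : realType} {n : nat}.
Implicit Types (f g : 'rV[R]_n -> Rcomplex R) (E : test_kind).

Definition is_test E f : Prop :=
  match E with
  | CompactSupport => smooth f /\ exists2 m, (0 < m)%N & supported_in m f
  | RapidDecrease => smooth f /\ rapidly_decreasing f
  end.

Lemma is_test_smooth E f : is_test E f -> smooth f.
Proof. by case: E => -[]. Qed.

Lemma is_test0 E : is_test E 0.
Proof.
case: E; split; try exact: smooth0; first by exists 1%N.
by move=> k q; exists 0 => x; rewrite Dmi0 scaler0 normr0.
Qed.

Lemma is_testD E f g : is_test E f -> is_test E g -> is_test E (f + g).
Proof.
case: E => -[sf tf] [sg tg]; split; try exact: smoothD.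
- have [[m m0 fm] [l l0 gl]] := (tf, tg).
  exists (maxn m l); first by rewrite leq_max m0.
  move=> x xml; rewrite -[LHS]/(f x + g x) fm ?gl ?addr0//.
  + by apply: le_lt_trans xml; rewrite ler_nat leq_maxr.
  + by apply: le_lt_trans xml; rewrite ler_nat leq_maxl.
- exact: rapidly_decreasingD.
Qed.

Lemma is_testZ E c f : is_test E f -> is_test E (Rcomplex_mul c \o f).
Proof.
case: E => -[sf tf]; split; try exact: smoothZ.
- have [m m0 fm] := tf; exists m => // x xm.
  by rewrite /= /Rcomplex_mul fm// mulr0.
- exact: rapidly_decreasingZ.
Qed.

Lemma is_testN E f : is_test E f -> is_test E (- f).
Proof.
have -> : - f = Rcomplex_mul (-1) \o f.
  by apply/funext => x /=; rewrite /Rcomplex_mul mulN1r.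
exact: is_testZ.
Qed.

Lemma is_test_Dmi E a f : is_test E f -> is_test E (Dmi a f).
Proof.
case: E => -[sf tf]; split; try exact: smooth_Dmi.
- by have [m m0 fm] := tf; exists m => //; rewrite DmiE; exact: partials_support.
- exact: rapidly_decreasing_Dmi.
Qed.

Lemma supported_in_translate m f y : supported_in m f ->
  exists2 m', (0 < m')%N & supported_in m' (fun z => f (y + z)).
Proof.
move=> fm.
pose K : R := Num.sqrt (\sum_i (m%:R + `|y 0 i|) ^+ 2).
exists (Num.bound K).+1 => // x xK; apply: fm; rewrite ltNge; apply/negP => yx.
move: xK; apply/negP; rewrite -leNgt.
have Kb : K <= (Num.bound K).+1%:R.
  by rewrite ltW// (lt_trans (archi_boundP (sqrtr_ge0 _)))// ltr_nat.
apply: le_trans Kb; rewrite ler_sqrt; last by apply: sumr_ge0 => i _; exact: sqr_ge0.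
apply: ler_sum => i _; rewrite -(normr_id (y 0 i)) -[X in X <= _]real_normK ?num_real//.
rewrite lerXn2r ?nnegrE ?addr_ge0// normr_id.
have yxi : `|y 0 i + x 0 i| <= m%:R.
  apply: le_trans yx; rewrite -sqrtr_sqr /enorm ler_sqrt.
    by rewrite (bigD1 i)//= mxE lerDl; apply: sumr_ge0 => j _; exact: sqr_ge0.
  by apply: sumr_ge0 => j _; exact: sqr_ge0.
rewrite -{1}(addKr (y 0 i) (x 0 i)) addrC.
by rewrite (le_trans (ler_normB _ _))// lerD2r.
Qed.

Lemma is_test_translate E f y : is_test E f -> is_test E (fun z => f (y + z)).
Proof.
case: E => -[sf tf]; split; try exact: smooth_translate.
- by have [m m0 fm] := tf; exact: supported_in_translate fm.
- exact: rapidly_decreasing_translate.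
Qed.

Definition test_pred E : {pred 'rV[R]_n -> Rcomplex R} := fun f => `[< is_test E f >].

Lemma test_predP E f : reflect (is_test E f) (f \in test_pred E).
Proof. exact: asboolP. Qed.

Lemma test_pred_zmod_closed E : zmod_closed (test_pred E).
Proof.
split=> [|f g /test_predP tf /test_predP tg]; first exact/test_predP/is_test0.
by apply/test_predP; apply: is_testD => //; exact: is_testN.
Qed.

HB.instance Definition _ E :=
  GRing.isZmodClosed.Build _ (test_pred E) (test_pred_zmod_closed E).

End test_space.

Arguments is_test {R n}.
Arguments test_pred {R n}.

(* test R n CompactSupport is the space D of R^n and test R n RapidDecrease is
   the space S. *)
Record test (R : realType) (n : nat) (E : test_kind) := Test {
  test_fun :> 'rV[R]_n -> Rcomplex R ;
  test_funP : test_fun \in test_pred E }.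

Section test_lmodType.
Context {R : realType} {n : nat} {E : test_kind}.
Local Notation T := (test R n E).

HB.instance Definition _ := [isSub of T for @test_fun R n E].
HB.instance Definition _ := [Choice of T by <:].
HB.instance Definition _ := [SubChoice_isSubZmodule of T by <:].

Lemma test_is_test (xi : T) : is_test E xi.
Proof. exact/test_predP/test_funP. Qed.

Lemma test_smooth (xi : T) : smooth xi.
Proof. exact: is_test_smooth (test_is_test xi). Qed.

Lemma test_ext (xi eta : T) : xi =1 eta -> xi = eta.
Proof. by move=> xe; apply: val_inj; exact/funext. Qed.

Definition mk_test f (tf : is_test E f) : T := Test (introT (test_predP E f) tf).

Definition test_scale (c : R[i]) (xi : T) : T :=
  mk_test (is_testZ c (test_is_test xi)).

Fact test_scaleA a b xi : test_scale a (test_scale b xi) = test_scale (a * b) xi.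
Proof. by apply: test_ext => x; exact: mulrA. Qed.

Fact test_scale1 : left_id 1 test_scale.
Proof. by move=> xi; apply: test_ext => x; exact: mul1r. Qed.

Fact test_scaleDr : right_distributive test_scale +%R.
Proof. by move=> c xi eta; apply: test_ext => x; exact: mulrDr. Qed.

Fact test_scaleDl xi : {morph test_scale^~ xi : a b / a + b}.
Proof. by move=> a b; apply: test_ext => x; exact: mulrDl. Qed.

HB.instance Definition _ := GRing.Zmodule_isLmodule.Build R[i] T
  test_scaleA test_scale1 test_scaleDr test_scaleDl.

Lemma testD_E (xi eta : T) : test_fun (xi + eta) = test_fun xi + eta.
Proof. by []. Qed.

Lemma testZ_E (c : R[i]) (xi : T) : test_fun (c *: xi) = Rcomplex_mul c \o xi.
Proof. by []. Qed.

Lemma test0_E : test_fun (0 : T) = 0.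
Proof. by []. Qed.

Definition Dtest (a : multi_index n) (xi : T) : T :=
  mk_test (is_test_Dmi a (test_is_test xi)).

Definition translate (x : 'rV[R]_n) (xi : T) : T :=
  mk_test (is_test_translate x (test_is_test xi)).

Lemma DtestD a (xi eta : T) : Dtest a (xi + eta) = Dtest a xi + Dtest a eta.
Proof.
apply: val_inj; exact: (Dmi_add a (test_smooth xi) (test_smooth eta)).
Qed.

Lemma DtestZ a (c : R[i]) (xi : T) : Dtest a (c *: xi) = c *: Dtest a xi.
Proof. apply: val_inj; exact: (DmiZ c a (test_smooth xi)). Qed.

Lemma Dtest0 a : Dtest a 0 = 0.
Proof. apply: val_inj; exact: Dmi0. Qed.

Definition absolutely_convex (W : set T) :=
  forall (a b : R[i]) xi eta, `|a| + `|b| <= 1 -> W xi -> W eta ->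
    W (a *: xi + b *: eta).

(* For CompactSupport this is the strict inductive limit of
   the D_m: the finest locally convex topology making all inclusions of the
   D_m continuous. *)
Definition nbhs_zero : set_system T := fun U =>
  match E with
  | CompactSupport => exists W : set T, [/\ absolutely_convex W, W `<=` U &
      forall m, (0 < m)%N -> exists p, exists2 e : R, 0 < e &
        forall xi : T, supported_in m xi -> normD m p xi < e -> W xi]
  | RapidDecrease => exists p, exists2 e : R, 0 < e &
      forall xi : T, normS p xi < e -> U xi
  end.

Definition nbhs_test (xi : T) : set_system T :=
  fun U => nbhs_zero [set u | U (xi + u)].

End test_lmodType.

Section test_topology.
Context {R : realType} {n : nat}.

Lemma normD_0 m p : normD m p (0 : 'rV[R]_n -> Rcomplex R) <= 0.
Proof. by apply: normD_le => x q _ _; rewrite Dmi0 normr0. Qed.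

Lemma normS_0 p : normS p (0 : 'rV[R]_n -> Rcomplex R) <= 0.
Proof. by apply: normS_le => x k q _ _; rewrite Dmi0 scaler0 normr0. Qed.

Lemma normD_mono m p p' (f : 'rV[R]_n -> Rcomplex R) : smooth f -> (p <= p')%N ->
  normD m p f <= normD m p' f.
Proof.
move=> sf pp; apply: normD_le => x q xm qp.
by apply: normD_ub => //; exact: leq_trans pp.
Qed.

Lemma normD_scale m p c (f : 'rV[R]_n -> Rcomplex R) : smooth f ->
  normD m p (Rcomplex_mul c \o f) <= `|c| * normD m p f.
Proof.
move=> sf; apply: normD_le => x q xm qp; rewrite (DmiZ c q sf)/= Rcomplex_normM.
by rewrite ler_wpM2l// normD_ub.
Qed.

Lemma normD_Dmi m p a (f : 'rV[R]_n -> Rcomplex R) : smooth f ->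
  normD m p (Dmi a f) <= normD m (p + mi_deg a) f.
Proof.
move=> sf; apply: normD_le => x q xm qp; rewrite (DmiD q a sf).
by apply: normD_ub => //; rewrite mi_degD leq_add2r.
Qed.

Lemma rapid (xi : test R n RapidDecrease) : rapidly_decreasing xi.
Proof. by have [] := test_is_test xi. Qed.

Lemma normS_mono p p' (xi : test R n RapidDecrease) : (p <= p')%N ->
  normS p xi <= normS p' xi.
Proof.
move=> pp; apply: normS_le => x k q kp qp.
by apply: normS_ub; [exact: rapid|exact: leq_trans pp|exact: leq_trans pp].
Qed.

Lemma normS_add p (xi eta : test R n RapidDecrease) :
  normS p (xi + eta) <= normS p xi + normS p eta.
Proof.
apply: normS_le => x k q kp qp.
rewrite testD_E (Dmi_add q (test_smooth xi) (test_smooth eta)).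
rewrite [X in monomial x k *: X]/(_ + _) scalerDr.
rewrite (le_trans (ler_normD _ _))// lerD//; apply: normS_ub => //; exact: rapid.
Qed.

Lemma normS_Dmi p a (xi : test R n RapidDecrease) :
  normS p (Dmi a xi) <= normS (p + mi_deg a) xi.
Proof.
apply: normS_le => x k q kp qp; rewrite (DmiD q a (test_smooth xi)).
apply: normS_ub; [exact: rapid|exact: leq_trans (leq_addr _ _)|].
by rewrite mi_degD leq_add2r.
Qed.

Context {E : test_kind}.
Implicit Types (U V : set (test R n E)).

Lemma nbhs_zeroS U V : U `<=` V -> nbhs_zero U -> nbhs_zero V.
Proof.
rewrite /nbhs_zero; case: E U V => U V UV.
- by case=> W [cW WU WP]; exists W; split=> //; exact: subset_trans UV.
- by case=> p [e e0 eU]; exists p, e => // xi /eU /UV.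
Qed.

Lemma nbhs_zeroT : nbhs_zero [set: test R n E].
Proof.
rewrite /nbhs_zero; case: E; last by exists 0%N, 1.
by exists setT; split=> // m _; exists 0%N, 1.
Qed.

Lemma nbhs_zeroI U V : nbhs_zero U -> nbhs_zero V -> nbhs_zero (U `&` V).
Proof.
rewrite /nbhs_zero; case: E U V => U V.
- move=> [W [cW WU WP]] [W' [cW' WV WP']]; exists (W `&` W'); split.
  + by move=> a b xi eta ab [? ?] [? ?]; split; [exact: cW|exact: cW'].
  + exact: setISS.
  + move=> m m0; have [p [e e0 pe]] := WP m m0; have [p' [e' e'0 pe']] := WP' m m0.
    exists (maxn p p'), (Num.min e e'); first by rewrite lt_min e0.
    move=> xi sxi; rewrite lt_min => /andP[xe xe']; split.
    * apply: pe => //; apply: le_lt_trans xe.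
      exact: normD_mono (test_smooth xi) (leq_maxl _ _).
    * apply: pe' => //; apply: le_lt_trans xe'.
      exact: normD_mono (test_smooth xi) (leq_maxr _ _).
- move=> [p [e e0 pe]] [p' [e' e'0 pe']].
  exists (maxn p p'), (Num.min e e'); first by rewrite lt_min e0.
  move=> xi; rewrite lt_min => /andP[xe xe']; split.
  + by apply: pe; apply: le_lt_trans xe; exact: normS_mono (leq_maxl _ _).
  + by apply: pe'; apply: le_lt_trans xe'; exact: normS_mono (leq_maxr _ _).
Qed.

Lemma nbhs_zero0 U : nbhs_zero U -> U 0.
Proof.
rewrite /nbhs_zero; case: E U => U.
- move=> [W [cW WU /(_ 1%N isT)[p [e e0 pe]]]]; apply/WU/pe => //.
  exact: le_lt_trans (normD_0 _ _) e0.
- by move=> [p [e e0 pe]]; apply: pe; exact: le_lt_trans (normS_0 _) e0.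
Qed.

Lemma nbhs_zero_half U : nbhs_zero U ->
  exists2 V, nbhs_zero V & forall u v, V u -> V v -> U (u + v).
Proof.
rewrite /nbhs_zero; case: E U => U.
- move=> [W [cW WU WP]].
  have half (u : test R n CompactSupport) : (2^-1 : R[i]) *: (2 *: u) = u.
    by rewrite scalerA mulVf ?scale1r// pnatr_eq0.
  exists [set u | W (2 *: u)]; last first.
    move=> u v Wu Wv; apply: WU; rewrite -(half u) -(half v); apply: cW => //.
    by rewrite ger0_norm ?invr_ge0 ?ler0n// -[2^-1]mul1r -splitr.
  exists [set u | W (2 *: u)]; split=> //.
    move=> a b xi eta ab Wxi Weta /=.
    have -> : 2 *: (a *: xi + b *: eta) = a *: (2 *: xi) + b *: (2 *: eta).
      by rewrite scalerDr !scalerA ![2 * _]mulrC.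
    exact: cW.
  move=> m m0; have [p [e e0 pe]] := WP m m0.
  pose c : Rcomplex R := (2 : R[i]).
  have c0 : 0 < `|c| + 1 by rewrite ltr_wpDl.
  exists p, (e / (`|c| + 1)); first by rewrite divr_gt0.
  move=> xi sxi; rewrite ltr_pdivlMr// => xe; apply: pe.
    by move=> x xm; rewrite testZ_E /= sxi// /Rcomplex_mul mulr0.
  rewrite testZ_E (le_lt_trans (normD_scale m p c (test_smooth xi)))//.
  apply: le_lt_trans xe; rewrite mulrC ler_wpM2l ?lerDl//.
  apply: (@le_trans _ _ `|Dmi [ffun=> 0%N] xi 0|) => //.
  apply: normD_ub; [exact: test_smooth| |].
    by rewrite /enorm big1 ?sqrtr0// => i _; rewrite mxE expr0n.
  by rewrite /mi_deg big1// => i _; rewrite ffunE.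
- move=> [p [e e0 pe]].
  exists [set u | normS p u < e / 2]; first by exists p, (e / 2) => //; rewrite divr_gt0.
  move=> u v /= ue ve; apply: pe; rewrite (splitr e).
  exact: le_lt_trans (normS_add _ _ _) (ltrD ue ve).
Qed.

Lemma nbhs_zero_Dtest a U : nbhs_zero U -> nbhs_zero [set u | U (Dtest a u)].
Proof.
rewrite /nbhs_zero; case: E U => U.
- move=> [W [cW WU WP]]; exists [set u | W (Dtest a u)]; split.
  + move=> b c xi eta bc Wxi Weta /=; rewrite DtestD !DtestZ; exact: cW.
  + by move=> u /= /WU.
  + move=> m m0; have [p [e e0 pe]] := WP m m0; exists (p + mi_deg a)%N, e => //.
    move=> xi sxi xe; apply: pe.
      by rewrite [test_fun _]DmiE; exact: partials_support.
    exact: le_lt_trans (normD_Dmi _ _ _ (test_smooth xi)) xe.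
- move=> [p [e e0 pe]]; exists (p + mi_deg a)%N, e => // xi xe; apply: pe.
  exact: le_lt_trans (normS_Dmi _ _ _) xe.
Qed.

Lemma nbhs_zeroZ (c : R[i]) U : `|c| <= 1 -> nbhs_zero U ->
  nbhs_zero [set u | U (c *: u)].
Proof.
move=> c1; rewrite /nbhs_zero; case: E U => U.
- move=> [W [cW WU WP]]; exists W; split=> // u Wu; apply: WU.
  by rewrite -[_ *: u]addr0 -(scale0r u); apply: cW => //; rewrite normr0 addr0.
- move=> [p [e e0 pe]]; exists p, e => // xi xe; apply: pe.
  apply: le_lt_trans xe; apply: normS_le => x k q kp qp.
  rewrite testZ_E (DmiZ c q (test_smooth xi))/= Rcomplex_scaler_mul Rcomplex_normM.
  apply: (@le_trans _ _ `|monomial x k *: Dmi q xi x|).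
    by rewrite ler_piMl// -lecR Rcomplex_normE.
  by apply: normS_ub => //; exact: rapid.
Qed.

HB.instance Definition _ := hasNbhs.Build (test R n E) (@nbhs_test R n E).

Fact nbhs_test_filter (xi : test R n E) : ProperFilter (nbhs xi).
Proof.
apply: Build_ProperFilter_ex; last split.
- by move=> U /nbhs_zero0/= U0; exists (xi + 0).
- exact: nbhs_zeroT.
- by move=> U V; exact: nbhs_zeroI.
- by move=> U V UV; apply: nbhs_zeroS => u; exact: UV.
Qed.

Fact nbhs_test_singleton (xi : test R n E) U : nbhs xi U -> U xi.
Proof. by move=> /nbhs_zero0; rewrite /= addr0. Qed.

Fact nbhs_test_nbhs (xi : test R n E) U : nbhs xi U -> nbhs xi (nbhs^~ U).
Proof.
move=> /nbhs_zero_half[V V0 VU]; apply: (nbhs_zeroS _ V0) => u Vu /=.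
by apply: (nbhs_zeroS _ V0) => v Vv /=; rewrite -addrA; exact: VU.
Qed.

HB.instance Definition _ := Nbhs_isNbhsTopological.Build (test R n E)
  nbhs_test_filter nbhs_test_singleton nbhs_test_nbhs.

Lemma nbhs0_test U : nbhs (0 : test R n E) U <-> nbhs_zero U.
Proof.
by split; apply: nbhs_zeroS => u /=; rewrite add0r.
Qed.

Lemma nbhs_testE (xi : test R n E) U :
  nbhs xi U <-> nbhs (0 : test R n E) [set u | U (xi + u)].
Proof. by rewrite nbhs0_test. Qed.

End test_topology.

Section functionals.
Context {R : realType} {n : nat} {E : test_kind}.
Local Notation T := (test R n E).
Implicit Types (U : set T) (gamma : R[i]^o -> R[i]^o) (f : T -> R[i]^o).

Definition dual f := linear f /\ continuous f.

Definition C0 gamma :=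
  [/\ gamma @ (0 : R[i]^o) --> (0 : R[i]^o), gamma 0 = 0 &
      forall t, `|t| <= 1 -> `|t| <= `|gamma t|].

Definition demi_distribution gamma U f :=
  [/\ continuous f, f 0 = 0 &
      forall (x u : T) (t : R[i]), U u -> `|t| <= 1 ->
        exists r s : R[i], [/\ `|r - 1| <= `|gamma t|, `|s| <= `|gamma t| &
                               f (x + t *: u) = r * f x + s * f u]].

Definition demi_span gamma U f :=
  exists (N : nat) (c : 'I_N -> R[i]) (g : 'I_N -> T -> R[i]^o),
    (forall i, demi_distribution gamma U (g i)) /\ f = \sum_i c i *: g i.

Definition Dfunctional (a : multi_index n) f : T -> R[i]^o :=
  fun xi => f ((-1) ^+ mi_deg a *: Dtest a xi).

Definition conv_fun (f0 : T -> R[i]^o) (xi : T) : 'rV[R]_n -> Rcomplex R :=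
  fun x => f0 (translate x xi).

(* The convolution f0 * xi as an element of E. It is 0 when conv_fun f0 xi is
   not in E, which never happens for a multiplier (convE), and the derivatives
   of a multiplier are multipliers (conv_multiplier_Dfunctional). *)
Definition conv (f0 : T -> R[i]^o) (xi : T) : T := insubd 0 (conv_fun f0 xi).

Definition conv_multiplier (f0 : T -> R[i]^o) :=
  (forall xi, is_test E (conv_fun f0 xi)) /\
  (forall xi : nat -> T, xi @ \oo --> (0 : T) ->
     (fun k => conv f0 (xi k)) @ \oo --> (0 : T)).

Definition conv_functional (f0 : T -> R[i]^o) f : T -> R[i]^o := fun xi => f (conv f0 xi).

Lemma conv_val (f0 : T -> R[i]^o) xi : is_test E (conv_fun f0 xi) ->
  test_fun (conv f0 xi) = conv_fun f0 xi.
Proof. by move=> tf; apply: insubdK; exact/test_predP. Qed.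

Lemma convE (f0 : T -> R[i]^o) xi x : conv_multiplier f0 ->
  conv f0 xi x = f0 (translate x xi).
Proof. by move=> [f0E _]; rewrite (conv_val (f0E xi)). Qed.

Lemma Dtest_continuous a : continuous (@Dtest R n E a).
Proof.
move=> xi U /nbhs_testE/nbhs0_test/(nbhs_zero_Dtest a) U0.
apply/nbhs_testE/nbhs0_test; apply: (nbhs_zeroS _ U0) => u /=.
by rewrite DtestD.
Qed.

Lemma cvg_testZ (c : R[i]) (xi : nat -> T) : `|c| <= 1 -> xi @ \oo --> (0 : T) ->
  (fun k => c *: xi k) @ \oo --> (0 : T).
Proof.
move=> c1 xi0 U /nbhs0_test/(nbhs_zeroZ c1) U0.
exact: xi0 _ (proj2 (nbhs0_test _) U0).
Qed.

Lemma DfunctionalE a f : linear f ->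
  Dfunctional a f = (fun xi => (-1) ^+ mi_deg a * f (Dtest a xi)).
Proof.
move=> lf; apply/funext => xi; rewrite /Dfunctional.
have f0 : f 0 = 0 by have := lf (-1) 0 0; rewrite !scaleN1r oppr0 addr0 addNr.
by rewrite -[_ *: Dtest a xi]addr0 lf f0 addr0.
Qed.

Lemma dual_Dfunctional a f : dual f -> dual (Dfunctional a f).
Proof.
move=> [lf cf]; split.
- move=> c u v; rewrite !(DfunctionalE a lf) DtestD DtestZ lf.
  by rewrite mulrDr /GRing.scale/= mulrCA.
- rewrite (DfunctionalE a lf) => xi.
  have cfD : {for xi, continuous (f \o Dtest a)}.
    exact: continuous_comp (@Dtest_continuous a xi) (cf _).
  exact: (continuous_comp cfD (@scaler_continuous _ R[i]^o ((-1) ^+ mi_deg a) _)).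
Qed.

Lemma conv_multiplier_Dfunctional a (f0 : T -> R[i]^o) : dual f0 ->
  conv_multiplier f0 -> conv_multiplier (Dfunctional a f0).
Proof.
move=> [lf cf] mf; have [f0E f00] := mf.
have E1 xi : conv_fun (Dfunctional a f0) xi =
    Rcomplex_mul ((-1 : R[i]) ^+ mi_deg a) \o conv_fun f0 (Dtest a xi).
  apply/funext => x; rewrite /conv_fun (DfunctionalE a lf)/=.
  congr (_ * f0 _); apply: test_ext => y /=.
  by rewrite Dmi_translate.
have t1 xi : is_test E (conv_fun (Dfunctional a f0) xi).
  by rewrite E1; exact: is_testZ.
split=> // xi xi0.
have -> : (fun k => conv (Dfunctional a f0) (xi k)) =
    (fun k => (-1) ^+ mi_deg a *: conv f0 (Dtest a (xi k))).
  apply/funext => k; apply: test_ext => x.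
  by rewrite testZ_E/= (conv_val (t1 _)) (conv_val (f0E _)) E1.
apply: cvg_testZ; first by rewrite normrX normrN1 expr1n.
apply: f00; rewrite -(Dtest0 a).
exact: (continuous_cvg _ (@Dtest_continuous a 0)).
Qed.

End functionals.

(* Main.v *)
Require Import Defs.
From HB Require Import structures.
From mathcomp Require Import all_boot all_order all_algebra.
From mathcomp Require Import boolp classical_sets functions reals.
From mathcomp Require Import topology normedtype landau derive realfun.
From mathcomp Require Import complex.

(** The heart of the matter is [D^a (f * xi) = f * D^a xi] for a multiplier
    [f] in the dual of [E]; everything about functionals follows from it by
    unfolding, since [D^a] and the convolution act on a functional only through
    its argument.

    By induction on the number of derivatives it suffices to treat one partial
    derivative. Write [tau_y] for the translation by [y]. As [f] is linear, the
    difference quotient of [f * xi] at [x] in the direction [e_i] is the value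
    of [f] at the difference quotient of [tau_x xi], so the continuity of [f]
    reduces the claim to a statement about test functions: the remainder
      [h^-1 (tau_(h e_i) xi - xi) - d_i xi]
    tends to 0 in [E] when [h] tends to 0. Right limits are enough, because the
    multiplier hypothesis already makes [f * xi] differentiable; this is what
    identifies its derivative ([partial_conv_fun]).

    The remainder commutes with every [D^q], and two applications of the mean
    value theorem bound it pointwise by [2 h] times any bound for [d_i d_i xi]
    on the segment of length [h] ([diff_quot_remainder_le]). Rapidly decreasing
    functions keep their weighted bounds under bounded translations
    ([rapidly_decreasing_translate_unit]), which makes every seminorm of the
    remainder of order [h]. Compactly supported smooth functions are rapidly
    decreasing, so one estimate serves both spaces; in the compactly supported
    case the remainders moreover share one support ([dq_remainder_small]). *)

Set Implicit Arguments.
Unset Strict Implicit.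
Unset Printing Implicit Defensive.

Import Order.TTheory GRing.Theory Num.Theory.
Import numFieldNormedType.Exports.
Local Open Scope classical_set_scope.
Local Open Scope ring_scope.
Local Open Scope complex_scope.

(** * Words of partial derivatives and multi-indices *)

Section partial_words.
Context {R : realType} {n : nat}.
Implicit Types (f : 'rV[R]_n -> Rcomplex R) (q : multi_index n).

Lemma partials_Dmi (s : seq 'I_n) f : smooth f ->
  partials s f = Dmi [ffun j => count_mem j s] f.
Proof.
move=> sf; rewrite DmiE; apply: partials_perm => //.
by apply/allP => j _ /=; rewrite count_mi_word ffunE.
Qed.

Lemma partial_Dmi i q f : smooth f -> partial i (Dmi q f) = Dmi q (partial i f).
Proof.
move=> sf; rewrite !DmiE.
rewrite -[LHS]/(partials (i :: mi_word q) f) -[partial i f]/(partials [:: i] f).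
by rewrite -partials_cat; apply: partials_perm => //; rewrite cats1 perm_sym perm_rcons.
Qed.

End partial_words.

(** * Bounds that are uniform under small translations *)

Section rapid_decrease.
Context {R : realType} {n : nat}.
Implicit Types (f : 'rV[R]_n -> Rcomplex R) (x y : 'rV[R]_n).
Implicit Types (q k : multi_index n).

Lemma coord_le_enorm x i : `|x 0 i| <= enorm x.
Proof.
rewrite -sqrtr_sqr ler_sqrt; last by apply: sumr_ge0 => j _; exact: sqr_ge0.
by rewrite (bigD1 i)//= lerDl; apply: sumr_ge0 => j _; exact: sqr_ge0.
Qed.

(** On the ball containing the support each coordinate is at most [m], and
    [D^q f] is bounded by compactness; outside it vanishes. *)
Lemma supported_rapidly_decreasing m f : smooth f -> supported_in m f ->
  rapidly_decreasing f.
Proof.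
move=> sf fm k q.
have [M MP] := compact_bound m (@Dmi_continuous _ _ q _ sf).
exists ((\prod_i (m%:R : R) ^+ k i) * `|M|) => x; rewrite normrZ.
have P0 : 0 <= \prod_i (m%:R : R) ^+ k i.
  by apply: prodr_ge0 => i _; rewrite exprn_ge0.
have [xm|mx] := leP (enorm x) m%:R; last first.
  by rewrite DmiE (partials_support (mi_word q) fm)// normr0 mulr0 mulr_ge0.
apply: ler_pM => //; last by rewrite (le_trans (MP _ xm))// ler_norm.
rewrite /monomial normr_prod; apply: ler_prod => i _; rewrite normr_ge0/= normrX.
by rewrite lerXn2r ?nnegrE// (le_trans (coord_le_enorm x i)).
Qed.

(** A point of the translated support has all coordinates at most [m + 1], hence
    lies in a ball whose radius does not depend on the translation. *)
Lemma supported_in_translate_unit m f : supported_in m f ->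
  exists2 m', (0 < m')%N & forall y, (forall j, `|y 0 j| <= 1) ->
    supported_in m' (fun x => f (y + x)).
Proof.
move=> fm; pose K : R := Num.sqrt (\sum_(i < n) (m%:R + 1) ^+ 2).
exists (Num.bound K).+1 => // y y1 x xK; apply: fm; rewrite ltNge; apply/negP => yx.
move: xK; apply/negP; rewrite -leNgt.
have Kb : K <= (Num.bound K).+1%:R.
  by rewrite ltW// (lt_trans (archi_boundP (sqrtr_ge0 _)))// ltr_nat.
apply: le_trans Kb; rewrite ler_sqrt; last by apply: sumr_ge0 => i _; exact: sqr_ge0.
apply: ler_sum => i _; rewrite -[X in X <= _]real_normK ?num_real//.
rewrite lerXn2r ?nnegrE ?addr_ge0//.
have := le_trans (coord_le_enorm (y + x) i) yx; rewrite mxE => yxi.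
rewrite -{1}(addKr (y 0 i) (x 0 i)) addrC.
by rewrite (le_trans (ler_normB _ _))// lerD.
Qed.

(** Since [|x_i| <= |x_i + y_i| + 1], each factor of the monomial costs at most
    [(t + 1)^k <= 2^k (1 + t^k)] with [t = |x_i + y_i|], a weight taken at the
    translated point and independent of [y]. *)
Lemma rapidly_decreasing_translate_unit f k q : rapidly_decreasing f ->
  exists M : R, forall x y, (forall j, `|y 0 j| <= 1) ->
    `|monomial x k *: Dmi q f (x + y)| <= M.
Proof.
move=> rf; have [M MP] := rapidly_decreasing_weight q k rf.
pose C : R := \prod_i 2 ^+ k i.
have C0 : 0 <= C by apply: prodr_ge0 => i _; rewrite exprn_ge0.
exists (C * M) => x y y1; rewrite normrZ.
apply: le_trans (ler_wpM2l C0 (MP (x + y))); rewrite mulrA ler_wpM2r//.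
rewrite /C -big_split/= /monomial normr_prod; apply: ler_prod => i _.
rewrite normr_ge0/= normrX mxE; set t := `|x 0 i + y 0 i|.
have t0 : 0 <= t by exact: normr_ge0.
have xt : `|x 0 i| <= t + 1.
  by rewrite -{1}(addrK (y 0 i) (x 0 i)) (le_trans (ler_normB _ _))// lerD.
apply: (@le_trans _ _ ((t + 1) ^+ k i)); first by rewrite lerXn2r ?nnegrE ?addr_ge0.
have [t1|t1] := leP t 1.
  apply: (@le_trans _ _ (2 ^+ k i)).
    by rewrite lerXn2r ?nnegrE ?addr_ge0// -[2]/(1 + 1) lerD2r.
  by rewrite ler_peMr ?exprn_ge0// lerDl exprn_ge0.
apply: (@le_trans _ _ ((2 * t) ^+ k i)).
  by rewrite lerXn2r ?nnegrE ?addr_ge0 ?mulr_ge0// mulr_natl mulr2n lerD2l ltW.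
by rewrite exprMn ler_wpM2l ?exprn_ge0// lerDr.
Qed.

Lemma test_rapid (E : test_kind) (xi : test R n E) : rapidly_decreasing xi.
Proof.
case: E xi => xi; last exact: rapid.
have [sxi [m _ xim]] := test_is_test xi.
exact: supported_rapidly_decreasing xim.
Qed.

End rapid_decrease.

(** * The remainder of the difference quotient *)

Lemma Rcomplex_norm_le (R : realType) (z : Rcomplex R) :
  `|z| <= `|complex.Re z| + `|complex.Im z|.
Proof.
case: z => a b; have -> : `|a +i* b : Rcomplex R| = Num.sqrt (a ^+ 2 + b ^+ 2).
  by [].
rewrite -[leRHS]ger0_norm ?addr_ge0// -sqrtr_sqr ler_sqrt ?sqr_ge0//= sqrrD.
by rewrite !real_normK ?num_real// addrAC lerDl mulrn_wge0// mulr_ge0.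
Qed.

Section difference_quotient_remainder.
Context {R : realType}.

(** The first mean value point [c] turns the remainder into the increment of
    ['D_u g] over [c], and the second one turns that increment into [c] times a
    second derivative. *)
Lemma diff_quot_remainder (V : normedModType R) (g : V -> R) (x u : V) (h : R) :
  0 < h -> (forall y, differentiable g y) ->
  (forall y, differentiable ('D_u g) y) ->
  exists2 d, 0 < d < h &
    `|h^-1 * (g (x + h *: u) - g x) - 'D_u g x| <=
      h * `|'D_u ('D_u g) (x + d *: u)|.
Proof.
move=> h0 dg ddg.
have [c /andP[c0 ch] ->] := MVT_line x u h0 dg.
have [d /andP[d0 dc] dE] := MVT_line x u c0 ddg.
exists d; first by rewrite d0 (lt_trans dc).
by rewrite mulKf ?gt_eqF// dE normrM gtr0_norm// ler_wpM2r// ltW.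
Qed.

Context {n : nat}.

(** The mean value theorem holds for real functions only, so it is applied to
    the real and the imaginary part separately, whence the factor 2. *)
Lemma diff_quot_remainder_le (i : 'I_n) (f : 'rV[R]_n -> Rcomplex R)
    (x : 'rV[R]_n) (h M : R) : smooth f -> 0 < h ->
  (forall d : R, 0 < d < h -> `|partial i (partial i f) (x + d *: 'e_i)| <= M) ->
  `|h^-1 *: (f (x + h *: 'e_i) - f x) - partial i f x| <= 2 * (h * M).
Proof.
move=> sf h0 fM.
have part (L : {linear Rcomplex R -> R}) : continuous L ->
    (forall z, `|L z| <= `|z|) ->
    `|L (h^-1 *: (f (x + h *: 'e_i) - f x) - partial i f x)| <= h * M.
  move=> cL L1.
  have LE s : 'D_('e_i) (L \o partials s f) = L \o partials (i :: s) f.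
    by apply/funext => y; have [] := derive_lin ('e_i) cL (sf s y).
  have Ld s y : differentiable (L \o partials s f) y.
    by have [] := derive_lin 0 cL (sf s y).
  have E1 : 'D_('e_i) (L \o f) = L \o partial i f := LE [::].
  have E2 : 'D_('e_i) (L \o partial i f) = L \o partial i (partial i f) := LE [:: i].
  have d0 y : differentiable (L \o f) y := Ld [::] y.
  have d1 y : differentiable ('D_('e_i) (L \o f)) y by rewrite E1; exact: (Ld [:: i] y).
  have [d dh] := diff_quot_remainder x h0 d0 d1.
  have e1 : 'D_('e_i) (L \o f) x = L (partial i f x) := congr1 (fun g => g x) E1.
  have e2 y : 'D_('e_i) ('D_('e_i) (L \o f)) y = L (partial i (partial i f) y).
    apply: etrans (congr1 (fun g => g y) E2); congr ('D_('e_i) _ y); exact: E1.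
  rewrite e1 e2 => dE; rewrite linearB linearZ linearB/=.
  apply: le_trans dE _; rewrite ler_wpM2l ?(ltW h0)//.
  exact: le_trans (L1 _) (fM d dh).
apply: le_trans (Rcomplex_norm_le _) _; rewrite mulr_natl mulr2n; apply: lerD.
- apply: (part (@complex.Re R : {linear Rcomplex R -> R})).
    exact: ReRcomplex_continuous.
  case=> a b; rewrite {2}/Num.norm/= -[X in X <= _]sqrtr_sqr.
  by rewrite ler_sqrt ?lerDl ?addr_ge0 ?sqr_ge0.
- apply: (part (@complex.Im R : {linear Rcomplex R -> R})).
    exact: ImRcomplex_continuous.
  case=> a b; rewrite {2}/Num.norm/= -[X in X <= _]sqrtr_sqr.
  by rewrite ler_sqrt ?lerDr ?addr_ge0 ?sqr_ge0.
Qed.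

End difference_quotient_remainder.

Section difference_quotient_convergence.
Context {R : realType} {n : nat} {E : test_kind}.
Local Notation T := (test R n E).
Implicit Types (xi eta : T) (q k : multi_index n) (x : 'rV[R]_n).

(** [partials s xi] as an element of [E]: it is [D^a xi] for the multi-index [a]
    counting the letters of [s], and words suit induction better. *)
Definition word_test (s : seq 'I_n) xi : T := Dtest [ffun j => count_mem j s] xi.

Lemma word_testE s xi : test_fun (word_test s xi) = partials s xi.
Proof. by rewrite (partials_Dmi s (test_smooth xi)). Qed.

Definition dq_remainder (i : 'I_n) (h : R) xi : T :=
  (h^-1)%:C *: (translate (h *: 'e_i) xi - xi) - word_test [:: i] xi.

Lemma dq_remainderE i h xi x : dq_remainder i h xi x =
  h^-1 *: (xi (x + h *: 'e_i) - xi x) - partial i xi x.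
Proof.
rewrite /dq_remainder -[LHS]/(_ - word_test [:: i] xi x) word_testE.
rewrite [x + _]addrC -[LHS]/((h^-1)%:C * (xi (h *: 'e_i + x) - xi x) - partial i xi x).
congr (_ - _); move: (xi (h *: 'e_i + x) - xi x) => [a b].
by apply/eqP; rewrite eq_complex/= !mul0r subr0 addr0 !eqxx.
Qed.

Lemma Dtest_dq_remainder q i h xi :
  Dtest q (dq_remainder i h xi) = dq_remainder i h (Dtest q xi).
Proof.
have DN eta : Dtest q (- eta) = - Dtest q eta by rewrite -scaleN1r DtestZ scaleN1r.
rewrite /dq_remainder DtestD DN DtestZ DtestD DN; congr (_ *: (_ - _) - _).
  by apply: test_ext => x /=; rewrite Dmi_translate.
apply: val_inj; apply: etrans (congr1 (Dmi q) (word_testE [:: i] xi)) _.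
apply: etrans (esym (partial_Dmi i q (test_smooth xi))) _.
exact: esym (word_testE [:: i] (Dtest q xi)).
Qed.

(** The bound on the second derivative is weighted by the monomial, so it is
    divided by that weight, apart from the points where the weight vanishes. *)
Lemma dq_remainder_bound i k xi : exists M : R, forall x (h : R), 0 < h < 1 ->
  `|monomial x k *: dq_remainder i h xi x| <= h * M.
Proof.
have [M MP] := rapidly_decreasing_translate_unit k [ffun j => count_mem j [:: i; i]]
  (test_rapid xi).
exists (2 * M) => x h /andP[h0 h1]; rewrite dq_remainderE normrZ.
(* At such points only [0 <= M] matters, and the untranslated bound gives it. *)
have [->|m0] := eqVneq `|monomial x k| 0.
  rewrite mul0r; apply: mulr_ge0; first exact: ltW.
  apply: mulr_ge0 => //; apply: le_trans (normr_ge0 _) (MP x 0 _) => j.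
  by rewrite mxE normr0.
have m_gt0 : 0 < `|monomial x k| by rewrite lt_neqAle eq_sym m0/=.
have -> : h * (2 * M) = `|monomial x k| * (2 * (h * (M / `|monomial x k|))).
  by rewrite [RHS]mulrCA [in RHS](mulrCA _ h) [in RHS](mulrC _ (M / _)) divfK// mulrCA.
rewrite ler_pM2l//; apply: diff_quot_remainder_le => //; first exact: test_smooth.
move=> d /andP[d0 dh]; rewrite ler_pdivlMr// mulrC -normrZ.
have := MP x (d *: 'e_i); rewrite -(partials_Dmi [:: i; i] (test_smooth xi)).
apply=> j; rewrite !mxE/= normrM gtr0_norm//.
by case: (j == i); rewrite ?normr1 ?normr0 ?mulr1 ?mulr0// ltW// (lt_trans dh).
Qed.

(** As the remainder commutes with [D^q], the pointwise bound for [D^q xi]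
    controls its derivatives; a seminorm involves finitely many [k] and [q]. *)
Lemma dq_remainder_seminorm i p xi : exists C : R,
  forall x k q (h : R), (mi_deg k <= p)%N -> (mi_deg q <= p)%N -> 0 < h < 1 ->
  `|monomial x k *: Dmi q (dq_remainder i h xi) x| <= h * C.
Proof.
have /choice[B BP] : forall k, exists B : multi_index n -> R, forall q x (h : R),
    0 < h < 1 -> `|monomial x k *: dq_remainder i h (Dtest q xi) x| <= h * B q.
  move=> k; have [B BP] := choice (fun q => dq_remainder_bound i k (Dtest q xi)).
  by exists B.
have /choice[C CP] := fun k => bound_deg p (B k).
have [M MP] := bound_deg p C.
exists M => x k q h kp qp h01; have /andP[h0 _] := h01.
rewrite -[Dmi q _]/(test_fun (Dtest q (dq_remainder i h xi))) Dtest_dq_remainder.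
apply: le_trans (BP k q x h h01) _; rewrite ler_wpM2l ?(ltW h0)//.
exact: le_trans (CP k q qp) (MP k kp).
Qed.

End difference_quotient_convergence.

(** Convergence of the remainder to 0 in [E] as [h] decreases to 0. In the
    inductive limit a neighbourhood is tested on each step separately, so all
    the remainders with [h < 1] must live in one step. *)
Lemma dq_remainder_small (R : realType) n E (i : 'I_n) (xi : test R n E)
    (U : set (test R n E)) : nbhs_zero U ->
  exists2 d : R, 0 < d & forall h : R, 0 < h < d -> U (dq_remainder i h xi).
Proof.
have small p (e : R) : 0 < e -> exists2 d : R, 0 < d & forall h : R, 0 < h < d ->
    h < 1 /\ exists2 r, r < e & forall x k q, (mi_deg k <= p)%N -> (mi_deg q <= p)%N ->
      `|monomial x k *: Dmi q (dq_remainder i h xi) x| <= r.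
  move=> e0; have [C CP] := dq_remainder_seminorm i p xi.
  have C1 : 0 < `|C| + 1 by rewrite ltr_wpDl.
  exists (Num.min 1 (e / (`|C| + 1))); first by rewrite lt_min ltr01 divr_gt0.
  move=> h /andP[h0]; rewrite lt_min => /andP[h1 he]; split=> //.
  exists (h * (`|C| + 1)); first by rewrite -ltr_pdivlMr.
  move=> x k q kp qp; apply: le_trans (CP x k q h kp qp _) _; first by rewrite h0.
  by rewrite ler_wpM2l ?(ltW h0)// ltW// (le_lt_trans (ler_norm C))// ltrDl.
rewrite /nbhs_zero; case: E U xi small => U xi small.
- move=> [W [_ WU WP]].
  have [sxi [m0 m0_gt0 xim0]] := test_is_test xi.
  have [m m_gt0 tm] := supported_in_translate_unit xim0.
  have [p [e e0 pe]] := WP m m_gt0.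
  have [d d0 dP] := small p e e0.
  exists d => // h hd; have [h1 [r re rP]] := dP h hd; have /andP[h0 _] := hd.
  apply/WU/pe; last first.
    apply: le_lt_trans re; apply: normD_le => x q _ qp.
    (* The unweighted seminorms are the case of the multi-index 0. *)
    have m1 : monomial x [ffun=> 0%N] = 1.
      by rewrite /monomial big1// => j _; rewrite ffunE expr0.
    rewrite -[Dmi q _ x]scale1r -m1; apply: rP => //.
    by rewrite /mi_deg big1// => j _; rewrite ffunE.
  have t0 : supported_in m xi.
    move=> x xm; have := tm 0 _ x xm; rewrite add0r; apply=> j.
    by rewrite mxE normr0.
  move=> x xm; rewrite dq_remainderE addrC (t0 x xm).
  rewrite addrC [x + _]addrC (tm _ _ _ xm).
    have -> : partial i xi x = 0 by exact: (@partials_support _ _ m [:: i] xi t0 x xm).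
    by rewrite !subr0 scaler0.
  move=> j; rewrite !mxE/= normrM gtr0_norm//.
  by case: (j == i); rewrite ?normr1 ?normr0 ?mulr1 ?mulr0// ltW.
- move=> [p [e e0 pe]].
  have [d d0 dP] := small p e e0.
  exists d => // h hd; have [h1 [r re rP]] := dP h hd.
  apply: pe; apply: le_lt_trans re.
  by apply: normS_le => x k q kp qp; exact: rP.
Qed.

(** * Derivatives of convolutions *)

Section convolution_derivatives.
Context {R : realType} {n : nat} {E : test_kind}.
Local Notation T := (test R n E).
Implicit Types (xi eta : T) (f : T -> R[i]^o).

Lemma dual0 f : dual f -> f 0 = 0.
Proof. by move=> [lf _]; have := lf (-1) 0 0; rewrite !scaleN1r oppr0 addr0 addNr. Qed.

(** By linearity [f] can be moved outside the difference quotient, because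
    [tau_(h e_i + x) xi = tau_(h e_i) (tau_x xi)]. *)
Lemma diff_quot_conv f xi i (x : 'rV[R]_n) (h : R) : dual f ->
  h^-1 *: (conv_fun f xi (h *: 'e_i + x) - conv_fun f xi x) -
    conv_fun f (word_test [:: i] xi) x
  = f (dq_remainder i h (translate x xi)).
Proof.
move=> df; have [lf _] := df.
have fB u v : f (u - v) = f u - f v.
  by rewrite -scaleN1r addrC lf scaleN1r addrC.
have fZ c u : f (c *: u) = c * f u.
  by rewrite -[c *: u]addr0 lf (dual0 df) addr0.
have W : word_test [:: i] (translate x xi) = translate x (word_test [:: i] xi).
  by apply: test_ext => y /=; rewrite Dmi_translate.
have S : translate (h *: 'e_i) (translate x xi) = translate (h *: 'e_i + x) xi.
  by apply: test_ext => y /=; rewrite addrA [x + _]addrC.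
rewrite /dq_remainder fB fZ fB W S /conv_fun.
congr (_ - _); move: (f _) (f _) => [a b] [c d].
by apply/eqP; rewrite eq_complex/= !mul0r subr0 addr0 !eqxx.
Qed.

(** The difference quotient of [f * xi] has a limit because [f * xi] is smooth,
    and its right limit is [f * d_i xi] because [f] is continuous and the
    remainder tends to 0 in [E]. *)
Lemma partial_conv_fun f xi i : dual f -> smooth (conv_fun f xi) ->
  partial i (conv_fun f xi) = conv_fun f (word_test [:: i] xi).
Proof.
move=> df sf; apply/funext => x; have [_ cf] := df.
pose dq (h : R) : Rcomplex R :=
  h^-1 *: (conv_fun f xi (h *: 'e_i + x) - conv_fun f xi x).
have c1 : dq @ 0^' --> (partial i (conv_fun f xi) x : Rcomplex R).
  have dx : derivable (conv_fun f xi) x 'e_i by exact: diff_derivable (sf [::] x).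
  exact: dx.
have c2 : dq @ 0^'+ --> (partial i (conv_fun f xi) x : Rcomplex R).
  apply: cvg_trans c1; apply: cvg_app.
  by apply: within_subset => h /= h0; rewrite gt_eqF.
have c3 : dq @ 0^'+ --> (conv_fun f (word_test [:: i] xi) x : Rcomplex R).
  apply/cvgrPdist_lt => e e0.
  have eC : 0 < e%:C by rewrite ltcR.
  have /cvgrPdist_lt/(_ _ eC) := cf 0; rewrite (dual0 df) => /nbhs0_test fe.
  have [d d0 dP] := dq_remainder_small i (translate x xi) fe.
  near=> h; rewrite distrC -ltcR Rcomplex_normE (diff_quot_conv xi i x h df).
  have : 0 < h < d by apply/andP; split; near: h; [exact: nbhs_right_gt|exact: nbhs_right_lt].
  by move=> /dP/=; rewrite sub0r normrN.
exact: (cvg_unique _ c2 c3).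
Unshelve. all: by end_near. Qed.

Lemma partials_conv_fun f xi s : dual f -> conv_multiplier f ->
  partials s (conv_fun f xi) = conv_fun f (word_test s xi).
Proof.
move=> df [mf _]; elim: s => [|i s IH].
  by congr conv_fun; apply: val_inj; exact: esym (word_testE [::] xi).
rewrite /= IH (partial_conv_fun _ df); last exact: is_test_smooth (mf _).
congr conv_fun; apply: val_inj; apply: etrans (word_testE _ _) _.
by rewrite word_testE; exact: esym (word_testE (i :: s) xi).
Qed.

Lemma Dtest_conv f xi a : dual f -> conv_multiplier f ->
  Dtest a (conv f xi) = conv f (Dtest a xi).
Proof.
move=> df mf; apply: val_inj; have [tf _] := mf.
apply: etrans (congr1 (Dmi a) (conv_val (tf xi))) _.
apply: etrans (esym (conv_val (tf (Dtest a xi)))).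
rewrite DmiE (partials_conv_fun _ _ df mf); congr conv_fun; apply: val_inj.
apply: etrans (word_testE _ _) _; exact: esym (DmiE a xi).
Qed.

(** The sign in the derivative of a functional moves to the argument of the
    convolution, since [D^a] commutes with translations. *)
Lemma conv_Dfunctional f xi a : dual f -> conv_multiplier f ->
  conv (Dfunctional a f) xi = conv f ((-1) ^+ mi_deg a *: Dtest a xi).
Proof.
move=> df mf; apply: test_ext => x.
rewrite !convE//; last exact: conv_multiplier_Dfunctional.
rewrite /Dfunctional; congr f; apply: test_ext => y /=.
by rewrite Dmi_translate.
Qed.

Lemma convZ f c xi : dual f -> conv_multiplier f ->
  conv f (c *: xi) = c *: conv f xi.
Proof.
move=> df mf; have [lf _] := df; apply: test_ext => x.
rewrite [RHS]/(c * conv f xi x) !convE//.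
have -> : translate x (c *: xi) = c *: translate x xi by exact: test_ext.
by rewrite -[c *: _]addr0 lf (dual0 df) addr0.
Qed.

End convolution_derivatives.

Theorem theorem4p3 (R : realType) (n : nat) (n_gt0 : (0 < n)%N)
    (E : test_kind) (U : set (test R n E)) (U0 : nbhs (0 : test R n E) U)
    (gamma : R[i]^o -> R[i]^o) (gammaC0 : C0 gamma)
    (f0 : test R n E -> R[i]^o) (f0_dual : dual f0)
    (f0_mult : conv_multiplier f0) (alpha : multi_index n) :
  (forall xi : test R n E,
     Dtest alpha (conv f0 xi) = conv f0 (Dtest alpha xi)) /\
  (forall f : test R n E -> R[i]^o, demi_span gamma U f ->
     Dfunctional alpha (conv_functional f0 f)
       = conv_functional (Dfunctional alpha f0) f /\
     conv_functional (Dfunctional alpha f0) f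
       = conv_functional f0 (Dfunctional alpha f)).
Proof.
split=> [xi|f _]; first exact: Dtest_conv.
rewrite /Dfunctional /conv_functional; split; apply/funext => xi.
  by rewrite conv_Dfunctional.
by rewrite conv_Dfunctional// convZ// Dtest_conv.
Qed.
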